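(* Let $\beta: I\to M\subset G^3$ be an arbitrary unit-speed curve on a surface $M$ in the Galilean space $G^3$, with geodesic curvature $\kappa_g$, normal curvature $\kappa_n$ and geodesic torsion $\tau_g$. Then the position vector of $\beta$ with respect to the standard frame is given by $$\begin{aligned}\beta(x)=\Bigg(x,\ &\int\Big[\int\Big(\kappa_g(x)S_{\tau_g}-\kappa_n(x)\int\tau_g(x)S_{\tau_g}\,dx\Big)dx\Big]dx,\\ &\int\Big[\int\Big(\kappa_g(x)C_{\tau_g}-\kappa_n(x)\int\tau_g(x)C_{\tau_g}\,dx\Big)dx\Big]dx\Bigg),\end{aligned}$$ where $C_{\tau_g}=\cos\big[\int\tau_g(x)\,dx\big]$ and $S_{\tau_g}=\sin\big[\int\tau_g(x)\,dx\big]$.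
   Context: The Galilean space $G^3$ is $\mathbb R^3$ with the scalar product $\mathbf v\cdot_G\mathbf w=v_1w_1$ if $v_1\ne0$ or $w_1\neq 0$, and $\mathbf v\cdot_G\mathbf w=v_2w_2+v_3w_3$ if $v_1=w_1=0$; the norm is $\|\mathbf v\|_G=\sqrt{|\mathbf v\cdot_G\mathbf v|}$ and the cross product is $\mathbf v\times_G\mathbf w=(0,\,v_3w_1-v_1w_3,\,v_1w_2-v_2w_1)$. A unit-speed curve (parametrized by arc length) is one of the form $\beta(x)=(x,y(x),z(x))$, $x\in I\subset\mathbb R$. Its Darboux frame with respect to $M$ is $\{\mathbf T,\mathbf Q,\mathbf n\}$ with $\mathbf T=\beta'$, $\mathbf n$ the unit normal of $M$ along $\beta$ (a vector field with first component $0$), and $\mathbf Q=\mathbf n\times_G\mathbf T$. The geodesic curvature $\kappa_g$, normal curvature $\kappa_n$ and geodesic torsion $\tau_g$ are the functions in $\mathbf T'=\kappa_g\mathbf Q+\kappa_n\mathbf n$, $\mathbf Q'=\tau_g\mathbf n$, $\mathbf n'=-\tau_g\mathbf Q$. The symbol $\int g(x)\,dx$ denotes an antiderivative of $g$, the constants of integration being suitably chosen. *)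

(* Defs.v *)
From Stdlib Require Export Reals.
From Coquelicot Require Export Coquelicot.

Open Scope R_scope.

Definition G3 : Type := (R * R * R)%type.

Definition c1 (v : G3) : R := fst (fst v).
Definition c2 (v : G3) : R := snd (fst v).
Definition c3 (v : G3) : R := snd v.

Definition gdot (v w : G3) : R :=
  if Req_EM_T (c1 v) 0 then
    if Req_EM_T (c1 w) 0 then c2 v * c2 w + c3 v * c3 w else c1 v * c1 w
  else c1 v * c1 w.

Definition gnorm (v : G3) : R := sqrt (Rabs (gdot v v)).

Definition gcross (v w : G3) : G3 :=
  (0, c3 v * c1 w - c1 v * c3 w, c1 v * c2 w - c2 v * c1 w).

(* Coquelicot's [Derive] is for real-valued functions only; the values of [D3]
   are meaningful where [ex_derive f x] holds. *)
Definition D3 (f : R -> G3) (x : R) : G3 :=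
  (Derive (fun t => c1 (f t)) x,
   Derive (fun t => c2 (f t)) x,
   Derive (fun t => c3 (f t)) x).

Definition open_interval (I : R -> Prop) : Prop :=
  open I /\ forall a b x, I a -> I b -> a <= x <= b -> I x.

Definition C1_on (I : R -> Prop) (f : R -> G3) : Prop :=
  forall x, I x -> ex_derive f x /\ continuous (D3 f) x.

Definition C2_on (I : R -> Prop) (f : R -> G3) : Prop :=
  C1_on I f /\ C1_on I (D3 f).

(* X : U -> M /\ V is a regular parametrization: of class C^1 with linearly
   independent partial derivatives Xu, Xv, and a homeomorphism whose inverse
   is Y.  No condition is put on X outside U, or on Y outside M /\ V. *)
Definition regular_chart (M V : G3 -> Prop) (U : R * R -> Prop)
    (X : R * R -> G3) : Prop :=
  open V /\ open U /\
  (exists Xu Xv : R * R -> G3, forall q, U q ->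
     filterdiff X (locally q)
       (fun h : R * R => plus (scal (fst h) (Xu q)) (scal (snd h) (Xv q))) /\
     continuous Xu q /\ continuous Xv q /\
     (forall a b : R,
        plus (scal a (Xu q)) (scal b (Xv q)) = zero -> a = 0 /\ b = 0)) /\
  (exists Y : G3 -> R * R,
     (forall q, U q -> M (X q) /\ V (X q) /\ Y (X q) = q) /\
     (forall p, M p -> V p ->
        U (Y p) /\ X (Y p) = p /\
        filterlim Y (within M (locally p)) (locally (Y p)))).

Definition regular_surface (M : G3 -> Prop) : Prop :=
  forall p, M p ->
    exists (V : G3 -> Prop) (U : R * R -> Prop) (X : R * R -> G3),
      V p /\ regular_chart M V U X.

(* Velocities at p of curves lying on M. *)
Definition tangent_vector (M : G3 -> Prop) (p w : G3) : Prop :=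
  exists a : R -> G3,
    a 0 = p /\ locally 0 (fun t => M (a t)) /\ is_derive a 0 w.

Definition unit_normal (M : G3 -> Prop) (p N : G3) : Prop :=
  c1 N = 0 /\ gnorm N = 1 /\ forall w, tangent_vector M p w -> gdot N w = 0.

Definition unit_normal_field_along
    (M : G3 -> Prop) (I : R -> Prop) (beta n : R -> G3) : Prop :=
  C1_on I n /\ forall x, I x -> unit_normal M (beta x) (n x).

Definition unit_speed (I : R -> Prop) (beta : R -> G3) : Prop :=
  exists y z : R -> R, forall x, I x -> beta x = (x, y x, z x).

Definition darboux_T (beta : R -> G3) : R -> G3 := D3 beta.

Definition darboux_Q (beta n : R -> G3) : R -> G3 :=
  fun x => gcross (n x) (darboux_T beta x).

Definition darboux_curvatures (I : R -> Prop) (beta n : R -> G3)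
    (kg kn tg : R -> R) : Prop :=
  let T := darboux_T beta in
  let Q := darboux_Q beta n in
  forall x, I x ->
    D3 T x = plus (scal (kg x) (Q x)) (scal (kn x) (n x)) /\
    D3 Q x = scal (tg x) (n x) /\
    D3 n x = opp (scal (tg x) (Q x)).

(* G is one of the functions denoted by the indefinite integral of g.  In the
   position-vector formula the integrals of tau_g inside the sine and inside the
   cosine have separate constants of integration: with Q = n x T one gets
   n = (0, cos A, sin A) and Q = (0, sin A, - cos A) with A' = tau_g, so the
   third coordinate needs cos (A + PI) where the second needs sin A, and a
   common constant is impossible in general. *)
Definition antiderivative (I : R -> Prop) (g G : R -> R) : Prop :=
  forall x, I x -> is_derive G x (g x).

(* Main.v *)
(** Because the first component of [T] is 1, [Q = n x T] equals [(0, n3, - n2)],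
    and [n' = - tau_g Q] says that the unit vector [(n2, n3)] rotates with angular
    velocity [tau_g].  Hence [(n2, n3) = (cos A, sin A)] for an antiderivative [A]
    of [tau_g], and the components of [T' = kappa_g Q + kappa_n n] are the stated
    integrands, with [sin A] in the second and [cos (A + PI)] in the third. *)
From Stdlib Require Import Lra Classical.
Require Import Defs.

(** A linear map is its own differential, so the chain rule applies directly. The maps in view are
    the coordinate projections [c1], [c2], [c3], which reduce vector statements in [G3] to real
    ones. *)
Lemma is_derive_linear_comp {V W : NormedModule R_AbsRing}
    (l : V -> W) (f : R -> V) (x : R) (d : V) :
  is_linear l -> is_derive f x d -> is_derive (fun t => l (f t)) x (l d).
Proof.
  intros Hl Hf.
  apply filterdiff_ext_lin with (l1 := fun h => l (scal h d)).
  - apply (filterdiff_comp' f l); [exact Hf |].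
    now apply filterdiff_linear.
  - intros h; apply (linear_scal l Hl).
Qed.

Lemma continuous_linear_comp {V W : NormedModule R_AbsRing}
    (l : V -> W) (f : R -> V) (x : R) :
  is_linear l -> continuous f x -> continuous (fun t => l (f t)) x.
Proof.
  intros Hl Hf; apply (continuous_comp f l); [exact Hf |].
  now apply linear_cont.
Qed.

Lemma is_linear_c1 : is_linear c1.
Proof.
  apply (is_linear_comp (fst : G3 -> R * R) (fst : R * R -> R)); apply is_linear_fst.
Qed.

Lemma is_linear_c2 : is_linear c2.
Proof.
  apply (is_linear_comp (fst : G3 -> R * R) (snd : R * R -> R));
    [apply is_linear_fst | apply is_linear_snd].
Qed.

Lemma is_linear_c3 : is_linear c3.
Proof. apply (@is_linear_snd R_AbsRing (prod_NormedModule _ _ _) R_NormedModule). Qed.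

(** [Derive] is a total function, so [D3] alone certifies nothing. Projecting a genuine derivative
    to the three coordinates identifies it with [D3 f x]. *)
Lemma is_derive_D3 (f : R -> G3) (x : R) : ex_derive f x -> is_derive f x (D3 f x).
Proof.
  intros [d Hd].
  replace (D3 f x) with d; [exact Hd |].
  transitivity (c1 d, c2 d, c3 d); [now destruct d as [[d1 d2] d3] |].
  symmetry; unfold D3; f_equal; [f_equal |]; apply is_derive_unique.
  - exact (is_derive_linear_comp c1 f x d is_linear_c1 Hd).
  - exact (is_derive_linear_comp c2 f x d is_linear_c2 Hd).
  - exact (is_derive_linear_comp c3 f x d is_linear_c3 Hd).
Qed.

Lemma interval_between (I : R -> Prop) (a b x : R) :
  open_interval I -> I a -> I b -> Rmin a b <= x <= Rmax a b -> I x.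
Proof.
  intros [_ HI] Ha Hb Hx.
  apply (HI (Rmin a b) (Rmax a b)); [| | exact Hx].
  - now apply Rmin_case.
  - now apply Rmax_case.
Qed.

Lemma derive_zero_constant (I : R -> Prop) (f : R -> R) (a b : R) :
  open_interval I -> (forall x, I x -> is_derive f x 0) -> I a -> I b -> f a = f b.
Proof.
  intros HI Hf Ha Hb.
  destruct (MVT_gen f a b (fun _ => 0)) as [c [_ Hc]].
  - intros x Hx; apply Hf, (interval_between I a b x HI Ha Hb); lra.
  - intros x Hx; apply derivable_continuous_pt; exists 0.
    apply is_derive_Reals, Hf, (interval_between I a b x HI Ha Hb Hx).
  - lra.
Qed.

Lemma antiderivative_add_const (I : R -> Prop) (g G : R -> R) (a : R) :
  antiderivative I g G -> antiderivative I g (fun x => G x + a).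
Proof.
  intros HG x Hx; rewrite <- (Rplus_0_r (g x)).
  apply (is_derive_plus G (fun _ => a)); [now apply HG |].
  exact (@is_derive_const R_AbsRing R_NormedModule a x).
Qed.

(** The integral from [x0], shifted by [a0]; the integration segment stays in [I] because [I] is an
    interval. The prescribed value at [x0] later serves as the initial angle. *)
Lemma continuous_antiderivative (I : R -> Prop) (g : R -> R) (x0 a0 : R) :
  open_interval I -> I x0 -> (forall x, I x -> continuous g x) ->
  exists G : R -> R, G x0 = a0 /\ antiderivative I g G.
Proof.
  intros HI H0 Hg.
  exists (fun x => RInt g x0 x + a0); split.
  - rewrite RInt_point; apply Rplus_0_l.
  - apply antiderivative_add_const; intros x Hx.
    apply (is_derive_RInt _ _ x0); [| now apply Hg].
    apply filter_imp with (2 := proj1 HI x Hx).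
    intros y Hy; apply (RInt_correct (V := R_CompleteNormedModule)), ex_RInt_continuous.
    intros z Hz; apply Hg, (interval_between I x0 y z HI H0 Hy Hz).
Qed.

(** The angle is [acos u] or its opposite, according to the sign of [v]. *)
Lemma unit_circle_angle (u v : R) :
  u * u + v * v = 1 -> exists a, cos a = u /\ sin a = v.
Proof.
  intros H.
  assert (Hu : -1 <= u <= 1) by nra.
  assert (Hs : sin (acos u) = Rabs v).
  { rewrite sin_acos by exact Hu.
    replace (1 - u²) with (v²) by (unfold Rsqr; lra).
    apply sqrt_Rsqr_abs. }
  destruct (Rle_dec 0 v) as [Hv | Hv].
  - exists (acos u); split; [now apply cos_acos |].
    rewrite Hs; now apply Rabs_pos_eq.
  - exists (- acos u); rewrite cos_neg, sin_neg; split; [now apply cos_acos |].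
    rewrite Hs, Rabs_left; lra.
Qed.

(** Both [(u, v)] and [(cos A, sin A)] solve the linear system [u' = - w v], [v' = w u] when
    [A' = w]. If [A] starts at an angle of [(u, v)] at one point, uniqueness for this system makes
    them agree on [I]. *)
Lemma rotation_angle (I : R -> Prop) (u v w : R -> R) :
  open_interval I ->
  (forall x, I x -> u x * u x + v x * v x = 1) ->
  (forall x, I x -> continuous w x) ->
  (forall x, I x -> is_derive u x (- (w x * v x))) ->
  (forall x, I x -> is_derive v x (w x * u x)) ->
  exists A, antiderivative I w A /\ forall x, I x -> cos (A x) = u x /\ sin (A x) = v x.
Proof.
  intros HI Huv Hw Hu Hv.
  destruct (classic (exists x0, I x0)) as [[x0 H0] | Hempty].
  2: { exists (fun _ => 0); split; intros x Hx; exfalso; eauto. }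
  destruct (unit_circle_angle _ _ (Huv x0 H0)) as [a0 [Hc Hs]].
  destruct (continuous_antiderivative I w x0 a0 HI H0 Hw) as [A [HA0 HA]].
  exists A; split; [exact HA |].
  intros x Hx.
  (* The squared distance between the two solutions: the system is a rotation, so its derivative is
     0, and it vanishes at [x0] by the choice of [a0]. *)
  pose (f := fun t => (u t - cos (A t)) ^ 2 + (v t - sin (A t)) ^ 2).
  assert (Hf : f x0 = f x).
  { apply (derive_zero_constant I); auto.
    intros t Ht; unfold f.
    pose proof (Hu t Ht) as Hu'; pose proof (Hv t Ht) as Hv'; pose proof (HA t Ht) as HA'.
    auto_derive.
    - repeat split; eexists; eassumption.
    - rewrite (is_derive_unique (fun x : R => u x) _ _ Hu').
      rewrite (is_derive_unique (fun x : R => v x) _ _ Hv').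
      rewrite (is_derive_unique (fun x : R => A x) _ _ HA').
      ring. }
  unfold f in Hf; rewrite HA0, Hc, Hs in Hf.
  destruct (Rplus_sqr_eq_0 (u x - cos (A x)) (v x - sin (A x))); [| lra].
  unfold Rsqr; ring_simplify in Hf; ring_simplify; lra.
Qed.

Lemma darboux_T_c1 (I : R -> Prop) (beta : R -> G3) (x : R) :
  open_interval I -> unit_speed I beta -> I x -> c1 (darboux_T beta x) = 1.
Proof.
  intros [HI _] [y [z Hb]] Hx.
  unfold darboux_T, D3, c1 at 1; simpl.
  (* The first coordinate of [beta] is known to be [t] only on [I]; openness of [I] makes this an
     equality near [x], which is enough for the derivative. *)
  apply is_derive_unique, (is_derive_ext_loc (fun t => t)).
  - apply filter_imp with (2 := HI x Hx).
    intros t Ht; now rewrite (Hb t Ht).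
  - exact (@is_derive_id R_AbsRing x).
Qed.

Lemma darboux_Q_eq (beta n : R -> G3) (x : R) :
  c1 (darboux_T beta x) = 1 -> c1 (n x) = 0 ->
  darboux_Q beta n x = (0, c3 (n x), - c2 (n x)).
Proof.
  intros HT Hn; unfold darboux_Q, gcross; rewrite HT, Hn.
  f_equal; [f_equal |]; ring.
Qed.

(** A vanishing first component selects the Euclidean branch of [gdot]; squaring the norm then gives
    the equation. *)
Lemma unit_normal_circle (M : G3 -> Prop) (p N : G3) :
  unit_normal M p N -> c2 N * c2 N + c3 N * c3 N = 1.
Proof.
  intros [H1 [H2 _]]; revert H2; unfold gnorm, gdot.
  destruct (Req_EM_T (c1 N) 0) as [_ | H]; [| contradiction].
  rewrite Rabs_pos_eq by nra.
  intros H2; rewrite <- (sqrt_sqrt (_ + _)) by nra.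
  rewrite H2; ring.
Qed.

Theorem theorem3p2
  (I : R -> Prop) (M : G3 -> Prop) (beta n : R -> G3) (kg kn tg : R -> R)
  (hI : open_interval I)
  (hM : regular_surface M)
  (hbeta : C2_on I beta)
  (hunit : unit_speed I beta)
  (hon : forall x, I x -> M (beta x))
  (hn : unit_normal_field_along M I beta n)
  (hk : darboux_curvatures I beta n kg kn tg) :
  exists AS AC : R -> R,
    antiderivative I tg AS /\ antiderivative I tg AC /\
    let Stg := fun x => sin (AS x) in
    let Ctg := fun x => cos (AC x) in
    exists PS PC Y1 Y Z1 Z : R -> R,
      antiderivative I (fun x => tg x * Stg x) PS /\
      antiderivative I (fun x => tg x * Ctg x) PC /\
      antiderivative I (fun x => kg x * Stg x - kn x * PS x) Y1 /\
      antiderivative I Y1 Y /\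
      antiderivative I (fun x => kg x * Ctg x - kn x * PC x) Z1 /\
      antiderivative I Z1 Z /\
      forall x, I x -> beta x = (x, Y x, Z x).
Proof.
  destruct hn as [hnC hnN]; destruct hbeta as [hb1 hb2].
  assert (HQ : forall x, I x -> darboux_Q beta n x = (0, c3 (n x), - c2 (n x))).
  { intros x Hx; apply darboux_Q_eq.
    - now apply (darboux_T_c1 I).
    - apply (hnN x Hx). }
  assert (Hcirc : forall x, I x -> c2 (n x) * c2 (n x) + c3 (n x) * c3 (n x) = 1).
  { intros x Hx; apply (unit_normal_circle M (beta x)), hnN, Hx. }
  (* The coordinates of [n' = - tg Q]: exactly the system treated by [rotation_angle], with [u], [v]
     the last two coordinates of [n]. *)
  assert (Hn' : forall x, I x ->
    c2 (D3 n x) = - (tg x * c3 (n x)) /\ c3 (D3 n x) = tg x * c2 (n x)).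
  { intros x Hx; destruct (hk x Hx) as [_ [_ H]].
    rewrite H, (HQ x Hx); split; [reflexivity |].
    change (- (tg x * - c2 (n x)) = tg x * c2 (n x)); ring. }
  assert (HT' : forall x, I x ->
    c2 (D3 (D3 beta) x) = kg x * c3 (n x) + kn x * c2 (n x) /\
    c3 (D3 (D3 beta) x) = kg x * - c2 (n x) + kn x * c3 (n x)).
  { intros x Hx; destruct (hk x Hx) as [H _].
    change (darboux_T beta) with (D3 beta) in H.
    rewrite H, (HQ x Hx); split; reflexivity. }
  (* Continuity of [tg] is not a hypothesis. It follows from [n] being of class C^1, since
     [tg = n2 n3' - n3 n2'] on [I] by the rotation equations and [n2^2 + n3^2 = 1]. *)
  assert (Htg : forall x, I x -> continuous tg x).
  { intros x Hx; destruct (hnC x Hx) as [Hex HcD].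
    assert (Hcn : continuous n x) by exact (ex_derive_continuous n x Hex).
    apply (continuous_ext_loc _
      (fun t => minus (mult (c2 (n t)) (c3 (D3 n t))) (mult (c3 (n t)) (c2 (D3 n t))))).
    - apply filter_imp with (2 := proj1 hI x Hx).
      intros t Ht; destruct (Hn' t Ht) as [-> ->].
      change (c2 (n t) * (tg t * c2 (n t)) - c3 (n t) * - (tg t * c3 (n t)) = tg t).
      transitivity (tg t * (c2 (n t) * c2 (n t) + c3 (n t) * c3 (n t))); [ring |].
      rewrite (Hcirc t Ht); ring.
    - apply (continuous_minus (V := R_NormedModule)).
      + apply (continuous_mult (K := R_AbsRing)).
        * exact (continuous_linear_comp c2 n x is_linear_c2 Hcn).
        * exact (continuous_linear_comp c3 (D3 n) x is_linear_c3 HcD).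
      + apply (continuous_mult (K := R_AbsRing)).
        * exact (continuous_linear_comp c3 n x is_linear_c3 Hcn).
        * exact (continuous_linear_comp c2 (D3 n) x is_linear_c2 HcD). }
  destruct (rotation_angle I (fun x => c2 (n x)) (fun x => c3 (n x)) tg)
    as [A [HA HAn]]; auto.
  { intros x Hx; rewrite <- (proj1 (Hn' x Hx)).
    apply (is_derive_linear_comp c2), is_derive_D3, hnC, Hx. apply is_linear_c2. }
  { intros x Hx; rewrite <- (proj2 (Hn' x Hx)).
    apply (is_derive_linear_comp c3), is_derive_D3, hnC, Hx. apply is_linear_c3. }
  exists A, (fun x => A x + PI).
  split; [exact HA |]; split; [now apply antiderivative_add_const |].
  cbv zeta.
  (* The constants in [PS] and [PC] are forced by the normal part of [T']: [- PS = cos A = n2] and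
     [- PC = - sin (A + PI) = sin A = n3]. The other four witnesses are coordinates of [T] and of
     [beta] itself, so no further constants have to be fitted. *)
  exists (fun x => - cos (A x)), (fun x => sin (A x + PI)),
    (fun x => c2 (D3 beta x)), (fun x => c2 (beta x)),
    (fun x => c3 (D3 beta x)), (fun x => c3 (beta x)).
  refine (conj _ (conj _ (conj _ (conj _ (conj _ (conj _ _)))))); intros x Hx.
  - pose proof (HA x Hx) as HA'; auto_derive; [now exists (tg x) |].
    rewrite (is_derive_unique (fun x : R => A x) _ _ HA'); ring.
  - pose proof (HA x Hx) as HA'; auto_derive; [now exists (tg x) |].
    rewrite (is_derive_unique (fun x : R => A x) _ _ HA'); ring.
  - destruct (HAn x Hx) as [-> ->].
    replace (_ - _) with (c2 (D3 (D3 beta) x)) by (rewrite (proj1 (HT' x Hx)); ring).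
    apply (is_derive_linear_comp c2), is_derive_D3, hb2, Hx. apply is_linear_c2.
  - apply (is_derive_linear_comp c2 beta x (D3 beta x)), is_derive_D3, hb1, Hx.
    apply is_linear_c2.
  - rewrite neg_cos, neg_sin; destruct (HAn x Hx) as [-> ->].
    replace (_ - _) with (c3 (D3 (D3 beta) x)) by (rewrite (proj2 (HT' x Hx)); ring).
    apply (is_derive_linear_comp c3), is_derive_D3, hb2, Hx. apply is_linear_c3.
  - apply (is_derive_linear_comp c3 beta x (D3 beta x)), is_derive_D3, hb1, Hx.
    apply is_linear_c3.
  - destruct hunit as [y [z Hb]]; rewrite (Hb x Hx); reflexivity.
Qed.
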